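(* Let $K$ be a commutative ring with unity, $v,w:\mathbb Z\to K$, and $\alpha,\beta\in\mathbb Z$. With the $\mathcal V$-Stirling numbers $c^{\mathcal V}_{\alpha,\beta}[n,k]$ and $S^{\mathcal V}_{\alpha,\beta}[n,k]$ as defined in the context, the following hold. (a) (Triangular recurrences) For all integers $n\ge 1$ and $k\ge 0$: $$c^{\mathcal V}_{\alpha,\beta}[n,k]=c^{\mathcal V}_{\alpha,\beta+1}[n-1,k-1]+v_{\alpha+n-1}w_{\beta}\,c^{\mathcal V}_{\alpha,\beta+1}[n-1,k],$$ $$S^{\mathcal V}_{\alpha,\beta}[n,k]=S^{\mathcal V}_{\alpha,\beta+1}[n-1,k-1]+v_{\alpha+k}w_{\beta}\,S^{\mathcal V}_{\alpha,\beta}[n-1,k].$$ (b) (Vertical recurrences) For all integers $n,k\ge 0$: $$c^{\mathcal V}_{\alpha,\beta}[n+1,k+1]=\sum_{j=k}^{n}\Big(\prod_{i=0}^{n-j-1} v_{\alpha+n-i}\,w_{\beta+i}\Big)\,c^{\mathcal V}_{\alpha,\beta+n-j+1}[j,k],$$ (i.e. the coefficient is $v_{\alpha+n}w_\beta v_{\alpha+n-1}w_{\beta+1}\cdots v_{\alpha+j+1}w_{\beta+n-j-1}$, empty product $=1$ when $j=n$), and $$S^{\mathcal V}_{\alpha,\beta}[n+1,k+1]=\sum_{j=k}^{n}\left(v_{\alpha+k+1}w_{\beta}\right)^{n-j}S^{\mathcal V}_{\alpha,\beta+1}[j,k].$$ (c) (Horizontal recurrences) For all integers $n,k\ge 0$: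 $$c^{\mathcal V}_{\alpha,\beta}[n,k]=\sum_{j=k}^{n}(-1)^{j-k}\left(v_{\alpha+n}w_{\beta-1}\right)^{j-k}c^{\mathcal V}_{\alpha,\beta-1}[n+1,j+1],$$ $$S^{\mathcal V}_{\alpha,\beta}[n,k]=\sum_{j=0}^{n-k}(-1)^{j}\Big(\prod_{i=1}^{j}v_{\alpha+k+i}w_{\beta-i}\Big)S^{\mathcal V}_{\alpha,\beta-j-1}[n+1,k+j+1].$$
   Context: Let $K$ be a commutative ring with unity and $v,w:\mathbb Z\to K$ functions; write $v_i=v(i)$, $w_i=w(i)$ and $\mathcal V=(v,w)$. For finitely many variables, $e_t$ denotes the $t$-th elementary symmetric function and $h_t$ the $t$-th complete homogeneous symmetric function, with $e_0=h_0=1$ and $e_t=h_t=0$ for $t<0$ (and $e_t=0$ when $t$ exceeds the number of variables). For $\alpha,\beta\in\mathbb Z$ and integers $n,k\ge 0$ define $$c^{\mathcal V}_{\alpha,\beta}[n,k]=e_{n-k}\big(v_{\alpha+n-1}w_{\beta},v_{\alpha+n-2}w_{\beta+1},\ldots,v_{\alpha}w_{\beta+n-1}\big)$$ (the $n$ arguments $v_{\alpha+n-1-i}w_{\beta+i}$, $0\le i\le n-1$), and $$S^{\mathcal V}_{\alpha,\beta}[n,k]=h_{n-k}\big(v_{\alpha+k}w_{\beta},v_{\alpha+k-1}w_{\beta+1},\ldots,v_{\alpha}w_{\beta+k}\big)$$ (the $k+1$ arguments $v_{\alpha+k-i}w_{\beta+i}$, $0\le i\le k$). In particular both vanish when $k>n$.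 If $n<0$ or $k<0$, both $c^{\mathcal V}_{\alpha,\beta}[n,k]$ and $S^{\mathcal V}_{\alpha,\beta}[n,k]$ are defined to be $0$. *)

(* Defs.v *)
From mathcomp Require Import all_boot all_order all_algebra.
From mathcomp Require Import mpoly.

Set Implicit Arguments.
Unset Strict Implicit.
Unset Printing Implicit Defensive.

Import GRing.Theory.
Local Open Scope ring_scope.

(* The multinomials library only has elementary symmetric polynomials, and only
   over nontrivial coefficient rings.  Both families are therefore given by
   their values at a finite family x over a possibly trivial commutative ring,
   with an integer degree, and are 0 in negative degree. *)
Definition esymf (K : comPzRingType) (m : nat) (x : 'I_m -> K) (t : int) : K :=
  if t is Posz d then \sum_(A : {set 'I_m} | #|A| == d) \prod_(i in A) x i
  else 0.

(* The sum ranges over exponent vectors a of total degree d; each exponent is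
   then at most d, whence the finite codomain 'I_d.+1. *)
Definition hsymf (K : comPzRingType) (m : nat) (x : 'I_m -> K) (t : int) : K :=
  if t is Posz d then
    \sum_(a : {ffun 'I_m -> 'I_d.+1} | (\sum_(i < m) a i)%N == d)
      \prod_(i < m) x i ^+ a i
  else 0.

Lemma esymf_mesym (K : comNzRingType) (m : nat) (x : 'I_m -> K) (d : nat) :
  esymf x d%:Z = (mesym m K d).@[x].
Proof.
rewrite /esymf /mesym rmorph_sum /=; apply: eq_bigr => A _.
by rewrite rmorph_prod /=; apply: eq_bigr => i _; rewrite mevalXU.
Qed.

Definition cV (K : comPzRingType) (v w : int -> K) (alpha beta n k : int) : K :=
  match n, k with
  | Posz n', Posz _ =>
      esymf (fun i : 'I_n' => v (alpha + n - 1 - i%:Z) * w (beta + i%:Z)) (n - k)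
  | _, _ => 0
  end.

Definition SV (K : comPzRingType) (v w : int -> K) (alpha beta n k : int) : K :=
  match n, k with
  | Posz _, Posz k' =>
      hsymf (fun i : 'I_k'.+1 => v (alpha + k - i%:Z) * w (beta + i%:Z)) (n - k)
  | _, _ => 0
  end.

(* Main.v *)
Require Import Defs.
From mathcomp Require Import all_boot all_order all_algebra.
From mathcomp Require Import zify ring.

Set Implicit Arguments.
Unset Strict Implicit.
Unset Printing Implicit Defensive.

Import GRing.Theory.
Local Open Scope ring_scope.

(** Removing the first variable x_0 of a finite family gives
    e_t(x) = e_t(x') + x_0 e_(t-1)(x') and h_t(x) = h_t(x') + x_0 h_(t-1)(x).
    For the families that define the Stirling numbers, these are the triangular
    recurrences. Iterating the latter yields the vertical recurrences, and
    solving them for their first term makes the horizontal sums telescope. *)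

(** * Monomial sums with bounded exponents, expanded along the first variable *)

Definition fcons (T : finType) m (c : T) (g : {ffun 'I_m -> T}) :
    {ffun 'I_m.+1 -> T} :=
  [ffun i => if unlift ord0 i is Some j then g j else c].

Lemma fcons0 (T : finType) m (c : T) (g : {ffun 'I_m -> T}) :
  fcons c g ord0 = c.
Proof. by rewrite ffunE unlift_none. Qed.

Lemma fcons_lift (T : finType) m (c : T) (g : {ffun 'I_m -> T}) i :
  fcons c g (lift ord0 i) = g i.
Proof. by rewrite ffunE liftK. Qed.

Lemma big_fcons (V : nmodType) (T : finType) m
    (P : pred {ffun 'I_m.+1 -> T}) (F : {ffun 'I_m.+1 -> T} -> V) :
  \sum_(f | P f) F f = \sum_(c : T) \sum_(g | P (fcons c g)) F (fcons c g).
Proof.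
rewrite pair_big_dep /=.
rewrite (reindex (fun p : T * {ffun 'I_m -> T} => fcons p.1 p.2)) //=.
exists (fun f : {ffun 'I_m.+1 -> T} => (f ord0, [ffun i => f (lift ord0 i)])).
  move=> [c g] _ /=; rewrite fcons0; congr (_, _).
  by apply/ffunP => i; rewrite ffunE fcons_lift.
move=> f _; apply/ffunP => i /=.
case: (unliftP ord0 i) => [j ->|->]; first by rewrite fcons_lift ffunE.
by rewrite fcons0.
Qed.

(* The sum of the monomials of degree d with all exponents at most D: it is e_d
   for D = 1, and h_d as soon as D >= d. *)
Definition bsymf (K : comPzRingType) (D m : nat) (x : 'I_m -> K) (d : nat) : K :=
  \sum_(a : {ffun 'I_m -> 'I_D.+1} | (\sum_(i < m) a i)%N == d)
    \prod_(i < m) x i ^+ a i.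

(** Sort the monomials by the exponent [c] of the first variable; the guard [c <= d] keeps the
    truncated subtraction [d - c] exact. *)
Lemma bsymf_recl (K : comPzRingType) (D m : nat) (x : 'I_m.+1 -> K) (d : nat) :
  bsymf D x d =
    \sum_(c < D.+1 | (c <= d)%N)
      x ord0 ^+ c * bsymf D (fun i => x (lift ord0 i)) (d - c).
Proof.
rewrite /bsymf big_fcons [RHS]big_mkcond /=; apply: eq_bigr => c _.
have degE (g : {ffun 'I_m -> 'I_D.+1}) :
    (\sum_(i < m.+1) fcons c g i = c + \sum_(i < m) g i)%N.
  rewrite big_ord_recl fcons0; congr (_ + _)%N.
  by apply: eq_bigr => i _; rewrite fcons_lift.
case: leqP => cd; last first.
  by apply: big_pred0 => g; rewrite degE; apply: gtn_eqF; apply: ltn_addr.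
rewrite big_distrr /=; apply: eq_big => [g|g _].
  by rewrite degE -[in RHS](eqn_add2l c) subnKC.
rewrite big_ord_recl fcons0; congr (_ * _).
by apply: eq_bigr => i _; rewrite fcons_lift.
Qed.

(** No exponent in a monomial of degree [d] exceeds [d]. Induction on the number of variables avoids
    a bijection between exponent vectors with different codomains. *)
Lemma bsymf_stable (K : comPzRingType) (D D' m : nat) (x : 'I_m -> K) (d : nat) :
  (d <= D)%N -> (d <= D')%N -> bsymf D x d = bsymf D' x d.
Proof.
elim: m x d => [|m IHm] x d leD leD'.
  rewrite /bsymf !(big_mkcond (fun a : {ffun _} => _ == d)) /=.
  (* Without variables there is a single exponent vector, whatever the cap. *)
  have const0 (T : finType) (z : K) : \sum_(a : {ffun 'I_0 -> T}) z = z.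
    by rewrite sumr_const card_ffun card_ord expn0.
  under eq_bigr do rewrite !big_ord0.
  under [RHS]eq_bigr do rewrite !big_ord0.
  by rewrite !const0.
(* The guard [c <= d] is turned into the range of [c], so that the two sums have the same index
   type. *)
have trunc E : (d <= E)%N -> bsymf E x d =
    \sum_(c < d.+1) x ord0 ^+ c * bsymf E (fun i => x (lift ord0 i)) (d - c).
  move=> leE; rewrite bsymf_recl.
  pose F c := x ord0 ^+ c * bsymf E (fun i => x (lift ord0 i)) (d - c).
  by rewrite (big_ord_widen E.+1 F).
rewrite !trunc //; apply: eq_bigr => c _.
by congr (_ * _); apply: IHm; lia.
Qed.

(** * Recursions for elementary and complete symmetric functions *)

Lemma esymf_bsymf (K : comPzRingType) m (x : 'I_m -> K) (d : nat) :
  esymf x d%:Z = bsymf 1 x d.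
Proof.
rewrite /esymf /bsymf.
(* A squarefree monomial corresponds to its support [S a]; the inverse is the indicator function. *)
pose S (a : {ffun 'I_m -> 'I_2}) := [set i | a i == 1%N :> nat].
have memS a i : (i \in S a) = a i :> nat.
  by rewrite inE; case: (a i) => [[|[|]]].
rewrite (reindex S) /=; last first.
  exists (fun A : {set 'I_m} => [ffun i => inord (i \in A) : 'I_2]).
    move=> a _; apply/ffunP => i; rewrite ffunE; apply: val_inj.
    by rewrite memS inord_val.
  move=> A _; apply/setP => i.
  by rewrite inE ffunE inordK; case: (i \in A).
apply: eq_big => [a|a _].
  by rewrite -sum1_card big_mkcond /=; congr (_ == d); apply: eq_bigr => i _;
     rewrite -memS; case: (i \in S a).
rewrite big_mkcond; apply: eq_bigr => i _.
by rewrite -memS; case: (i \in S a).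
Qed.

Lemma hsymf_bsymf (K : comPzRingType) m (x : 'I_m -> K) (D d : nat) :
  (d <= D)%N -> hsymf x d%:Z = bsymf D x d.
Proof. by move=> leD; rewrite -(@bsymf_stable _ d). Qed.

Lemma esymf_recl (K : comPzRingType) m (x : 'I_m.+1 -> K) (t : int) :
  esymf x t = esymf (fun i => x (lift ord0 i)) t
              + x ord0 * esymf (fun i => x (lift ord0 i)) (t - 1).
Proof.
case: t => [[|d]|d]; last by rewrite /= mulr0 addr0.
  (* In degree 0 the guard removes exponent 1, matching the value 0 of [esymf] in degree -1. *)
  rewrite !esymf_bsymf bsymf_recl big_mkcond 2!big_ord_recl big_ord0 /=.
  by rewrite expr0 mul1r subn0 mulr0 !addr0.
rewrite (_ : d.+1%:Z - 1 = d%:Z); last by lia.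
rewrite !esymf_bsymf bsymf_recl big_mkcond 2!big_ord_recl big_ord0 /=.
by rewrite expr0 mul1r expr1 subn0 subSS subn0 addr0.
Qed.

Lemma hsymf_recl (K : comPzRingType) m (x : 'I_m.+1 -> K) (t : int) :
  hsymf x t = hsymf (fun i => x (lift ord0 i)) t + x ord0 * hsymf x (t - 1).
Proof.
case: t => [[|d]|d]; last by rewrite /= mulr0 addr0.
  rewrite !(@hsymf_bsymf _ _ _ 0) // bsymf_recl big_mkcond big_ord_recl big_ord0.
  by rewrite /= expr0 mul1r mulr0 !addr0.
rewrite (_ : d.+1%:Z - 1 = d%:Z); last by lia.
(* The cap [d.+1] serves both degrees. Exponent 0 of the first variable gives the first term;
   lowering a positive exponent by one gives the second. *)
rewrite !(@hsymf_bsymf _ _ _ d.+1) // !bsymf_recl big_mkcond big_ord_recl /=.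
rewrite expr0 mul1r subn0 -big_mkcond /=; congr (_ + _).
(* In degree [d] the top exponent [d.+1] is excluded by the guard, so both ranges agree. *)
rewrite [in RHS]big_mkcond big_ord_recr /= ltnn addr0 -big_mkcond big_distrr.
by apply: eq_bigr => c _ /=; rewrite exprS mulrA.
Qed.

Lemma eq_esymf (K : comPzRingType) m (x y : 'I_m -> K) t :
  x =1 y -> esymf x t = esymf y t.
Proof.
move=> eq_xy; case: t => //= d; apply: eq_bigr => A _.
exact: eq_bigr.
Qed.

Lemma eq_hsymf (K : comPzRingType) m (x y : 'I_m -> K) t :
  x =1 y -> hsymf x t = hsymf y t.
Proof.
move=> eq_xy; case: t => //= d; apply: eq_bigr => a _.
by apply: eq_bigr => i _; rewrite eq_xy.
Qed.

Lemma esymf_gt (K : comPzRingType) m (x : 'I_m -> K) (d : nat) :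
  (m < d)%N -> esymf x d%:Z = 0.
Proof.
move=> lt_md; apply: big_pred0 => A; apply/negbTE.
by rewrite neq_ltn (leq_ltn_trans (max_card _)) ?card_ord.
Qed.

Lemma hsymf_none (K : comPzRingType) (x : 'I_0 -> K) (d : nat) :
  hsymf x d.+1%:Z = 0.
Proof. by apply: big_pred0 => a; rewrite big_ord0. Qed.

(** * Recurrences for the Stirling numbers *)

Section Stirling.
Variables (K : comPzRingType) (v w : int -> K) (alpha : int).

Lemma cV_small (beta : int) (n k : nat) :
  (n < k)%N -> cV v w alpha beta n%:Z k%:Z = 0.
Proof.
(* [Negz p] is -(p+1), hence the predecessor. *)
move=> lt_nk; rewrite /cV (_ : n%:Z - k%:Z = Negz (k - n).-1) //; lia.
Qed.

Lemma SV_small (beta : int) (n k : nat) :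
  (n < k)%N -> SV v w alpha beta n%:Z k%:Z = 0.
Proof.
move=> lt_nk; rewrite /SV (_ : n%:Z - k%:Z = Negz (k - n).-1) //; lia.
Qed.

Lemma cV_triangular (beta : int) (n : nat) (k : nat) :
  cV v w alpha beta n.+1%:Z k%:Z =
    cV v w alpha (beta + 1) n%:Z (k%:Z - 1)
    + v (alpha + n%:Z) * w beta * cV v w alpha (beta + 1) n%:Z k%:Z.
Proof.
rewrite {1}/cV esymf_recl.
rewrite (_ : alpha + n.+1%:Z - 1 - (@ord0 n)%:Z = alpha + n%:Z); last by rewrite /=; lia.
rewrite (_ : beta + (@ord0 n)%:Z = beta) ?addr0 //.
rewrite (_ : n.+1%:Z - k%:Z - 1 = n%:Z - k%:Z); last by lia.
have tailE t : esymf (fun i : 'I_n => v (alpha + n.+1%:Z - 1 - (lift ord0 i)%:Z)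
      * w (beta + (lift ord0 i)%:Z)) t
    = esymf (fun i : 'I_n => v (alpha + n%:Z - 1 - i%:Z) * w (beta + 1 + i%:Z)) t.
  by apply: eq_esymf => i; congr (v _ * w _); rewrite lift0; lia.
rewrite !tailE; congr (_ + _).
(* For [k = 0] the term with lower index -1 is 0 by convention; it faces the elementary symmetric
   function of degree [n.+1] in [n] variables. *)
case: k => [|k]; first by rewrite subr0 esymf_gt.
rewrite (_ : k.+1%:Z - 1 = k%:Z); last by lia.
by rewrite /cV; congr esymf; lia.
Qed.

Lemma SV_triangular (beta : int) (n k : nat) :
  SV v w alpha beta n.+1%:Z k%:Z =
    SV v w alpha (beta + 1) n%:Z (k%:Z - 1)
    + v (alpha + k%:Z) * w beta * SV v w alpha beta n%:Z k%:Z.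
Proof.
rewrite {1}/SV hsymf_recl /= subr0 addr0.
rewrite (_ : n.+1%:Z - k%:Z - 1 = n%:Z - k%:Z); last by lia.
(* For [k = 0] the only variable has been removed, and [hsymf] of positive degree in no variables is
   0, as is the term with index -1. *)
congr (_ + _); case: k => [|k]; first by rewrite subr0 hsymf_none.
rewrite (_ : k.+1%:Z - 1 = k%:Z); last by lia.
rewrite /SV (_ : n.+1%:Z - k.+1%:Z = n%:Z - k%:Z); last by lia.
by apply: eq_hsymf => i; congr (v _ * w _); rewrite /bump /=; lia.
Qed.

Lemma cV_triangularS (beta : int) (n k : nat) :
  cV v w alpha beta n.+1%:Z k.+1%:Z =
    cV v w alpha (beta + 1) n%:Z k%:Z
    + v (alpha + n%:Z) * w beta * cV v w alpha (beta + 1) n%:Z k.+1%:Z.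
Proof. by rewrite cV_triangular (_ : k.+1%:Z - 1 = k%:Z) //; lia. Qed.

Lemma SV_triangularS (beta : int) (n k : nat) :
  SV v w alpha beta n.+1%:Z k.+1%:Z =
    SV v w alpha (beta + 1) n%:Z k%:Z
    + v (alpha + k.+1%:Z) * w beta * SV v w alpha beta n%:Z k.+1%:Z.
Proof. by rewrite SV_triangular (_ : k.+1%:Z - 1 = k%:Z) //; lia. Qed.

(** Induction on [n] for all [beta], since the recurrence moves to [beta + 1]. Its first term is the
    summand with [j] maximal; its second prepends the factor [i = 0] to each product of the
    induction hypothesis. *)
Lemma cV_vertical (beta : int) (n k : nat) :
  cV v w alpha beta n.+1%:Z k.+1%:Z =
    \sum_(k <= j < n.+1)
      (\prod_(0 <= i < n - j) (v (alpha + n%:Z - i%:Z) * w (beta + i%:Z)))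
      * cV v w alpha (beta + n%:Z - j%:Z + 1) j%:Z k%:Z.
Proof.
elim: n beta => [|n IHn] beta.
  case: k => [|k]; last by rewrite big_geq // cV_small.
  rewrite big_nat1 big_geq // mul1r cV_triangularS (@cV_small _ 0 1) //.
  by rewrite mulr0 addr0; congr cV; lia.
have [le_kn|lt_nk] := leqP k n.+1; last by rewrite big_geq // cV_small.
rewrite big_nat_recr // subnn (@big_geq _ _ _ 0 0) // mul1r cV_triangularS addrC.
congr (_ + _); last by congr cV; lia.
rewrite IHn mulr_sumr; apply: eq_big_nat => j /andP[_ lt_jn].
rewrite mulrA (@subSn j n lt_jn) big_nat_recl //; congr (_ * _).
  rewrite subr0 addr0; congr (_ * _).
  by apply: eq_bigr => i _; congr (v _ * w _); lia.
by congr cV; lia.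
Qed.

(** Here the second term of the recurrence keeps both [beta] and the lower index, so the same factor
    recurs and a power replaces the product. *)
Lemma SV_vertical (beta : int) (n k : nat) :
  SV v w alpha beta n.+1%:Z k.+1%:Z =
    \sum_(k <= j < n.+1)
      (v (alpha + k%:Z + 1) * w beta) ^+ (n - j) * SV v w alpha (beta + 1) j%:Z k%:Z.
Proof.
have shiftE : alpha + k.+1%:Z = alpha + k%:Z + 1 by lia.
elim: n => [|n IHn].
  case: k shiftE => [|k] shiftE; last by rewrite big_geq // SV_small.
  by rewrite big_nat1 mul1r SV_triangularS (@SV_small _ 0 1) // mulr0 addr0.
have [le_kn|lt_nk] := leqP k n.+1; last by rewrite big_geq // SV_small.
rewrite big_nat_recr // subnn mul1r SV_triangularS addrC shiftE; congr (_ + _).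
rewrite IHn mulr_sumr; apply: eq_big_nat => j /andP[_ lt_jn].
by rewrite mulrA (@subSn j n lt_jn) exprS.
Qed.

Lemma cV_horizontal (beta : int) (n k : nat) :
  cV v w alpha beta n%:Z k%:Z =
    \sum_(k <= j < n.+1)
      (-1) ^+ (j - k) * (v (alpha + n%:Z) * w (beta - 1)) ^+ (j - k)
      * cV v w alpha (beta - 1) n.+1%:Z j.+1%:Z.
Proof.
have [le_kn|lt_nk] := leqP k n.+1; last by rewrite big_geq ?cV_small //; lia.
set x := v _ * w _.
(* The recurrence at [beta - 1] splits summand [j] into [- F j] and [F j.+1]. [F n.+1] vanishes, and
   [- F k] is the left-hand side. *)
pose F j := - ((- x) ^+ (j - k) * cV v w alpha beta n%:Z j%:Z).
rewrite (eq_big_nat _ _ (F2 := fun j => F j.+1 - F j)); last first.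
  move=> j /andP[le_kj _]; rewrite /F cV_triangularS subrK subSn // exprS.
  by rewrite -exprMn mulN1r -/x; ring.
by rewrite telescope_sumr // /F subnn (@cV_small _ n n.+1) // mulr0 oppr0 sub0r opprK mul1r.
Qed.

Lemma SV_horizontal (beta : int) (n k : nat) :
  SV v w alpha beta n%:Z k%:Z =
    \sum_(0 <= j < n.+1 - k)
      (-1) ^+ j
      * (\prod_(1 <= i < j.+1) (v (alpha + k%:Z + i%:Z) * w (beta - i%:Z)))
      * SV v w alpha (beta - j%:Z - 1) n.+1%:Z (k + j).+1%:Z.
Proof.
have [le_kn|lt_nk] := leqP k n.+1; last by rewrite big_geq ?SV_small //; lia.
(* Each use of the recurrence lowers [beta] by one and raises the lower index by one, so [F j] sits
   at [beta - j] and [k + j]; its last value has lower index [n.+1] and vanishes. *)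
pose F j := - ((-1) ^+ j
  * (\prod_(1 <= i < j.+1) (v (alpha + k%:Z + i%:Z) * w (beta - i%:Z)))
  * SV v w alpha (beta - j%:Z) n%:Z (k + j)%:Z).
rewrite (eq_big_nat _ _ (F2 := fun j => F j.+1 - F j)); last first.
  move=> j _; rewrite /F SV_triangularS subrK.
  rewrite (big_nat_recr j.+1) //= exprS addnS.
  rewrite (_ : alpha + k%:Z + j.+1%:Z = alpha + (k + j).+1%:Z); last by lia.
  rewrite (_ : beta - j.+1%:Z = beta - j%:Z - 1); last by lia.
  ring.
rewrite telescope_sumr // /F subnKC // (@SV_small _ n n.+1) // mulr0 oppr0 sub0r opprK.
by rewrite big_geq // !mul1r subr0 addn0.
Qed.

End Stirling.

Theorem theorem3p1 (K : comPzRingType) (v w : int -> K) (alpha beta : int) :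
  (* triangular recurrences *)
  [/\ forall n k : nat, (1 <= n)%N ->
        cV v w alpha beta n%:Z k%:Z =
          cV v w alpha (beta + 1) (n%:Z - 1) (k%:Z - 1)
          + v (alpha + n%:Z - 1) * w beta
            * cV v w alpha (beta + 1) (n%:Z - 1) k%:Z
    & forall n k : nat, (1 <= n)%N ->
        SV v w alpha beta n%:Z k%:Z =
          SV v w alpha (beta + 1) (n%:Z - 1) (k%:Z - 1)
          + v (alpha + k%:Z) * w beta
            * SV v w alpha beta (n%:Z - 1) k%:Z] /\
  (* vertical recurrences *)
  [/\ forall n k : nat,
        cV v w alpha beta (n%:Z + 1) (k%:Z + 1) =
          \sum_(k <= j < n.+1)
            (\prod_(0 <= i < n - j) (v (alpha + n%:Z - i%:Z) * w (beta + i%:Z)))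
            * cV v w alpha (beta + n%:Z - j%:Z + 1) j%:Z k%:Z
    & forall n k : nat,
        SV v w alpha beta (n%:Z + 1) (k%:Z + 1) =
          \sum_(k <= j < n.+1)
            (v (alpha + k%:Z + 1) * w beta) ^+ (n - j)
            * SV v w alpha (beta + 1) j%:Z k%:Z] /\
  (* horizontal recurrences *)
  [/\ forall n k : nat,
        cV v w alpha beta n%:Z k%:Z =
          \sum_(k <= j < n.+1)
            (-1) ^+ (j - k) * (v (alpha + n%:Z) * w (beta - 1)) ^+ (j - k)
            * cV v w alpha (beta - 1) (n%:Z + 1) (j%:Z + 1)
    (* the upper bound n.+1 - k makes the sum empty when n < k *)
    & forall n k : nat,
        SV v w alpha beta n%:Z k%:Z =
          \sum_(0 <= j < n.+1 - k)
            (-1) ^+ j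
            * (\prod_(1 <= i < j.+1) (v (alpha + k%:Z + i%:Z) * w (beta - i%:Z)))
            * SV v w alpha (beta - j%:Z - 1) (n%:Z + 1) (k%:Z + j%:Z + 1)].
Proof.
have addZ1 (m : nat) : m%:Z + 1 = m.+1%:Z by lia.
have subZ1 (m : nat) : m.+1%:Z - 1 = m%:Z by lia.
split; [split=> [[|n]|[|n]] // k _ | split; split=> n k].
- by rewrite -addrA !subZ1 cV_triangular.
- by rewrite !subZ1 SV_triangular.
- by rewrite !addZ1 cV_vertical.
- by rewrite !addZ1 SV_vertical.
- by rewrite cV_horizontal; apply: eq_bigr => j _; rewrite !addZ1.
- rewrite SV_horizontal; apply: eq_bigr => j _.
  by rewrite -PoszD !addZ1.
Qed.
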